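(* Let $\mathcal{L}$ be a complete modular lattice and let $\mathfrak{m}$ be a submonoid with zero of $\mathrm{End}_{lin}(\mathcal{L})$ that is closed under complements. Suppose that $(\mathfrak{m},+,\circ)$ is a semiring for some operation $+$ on $\mathfrak{m}$, where $\circ$ is composition, and that $\mathcal{L}$ is $\mathfrak{m}$-endoregular. If $C(\mathcal{L})$ is Boolean, then $\mathcal{L}$ is $\mathfrak{m}$-abelian.
   Context: $\mathbf{0},\mathbf{1}$ denote the least and greatest elements; $[a,b]=\{x: a\le x\le b\}$. An element $x$ has a complement if there is $x'$ with $x\wedge x'=\mathbf{0}$, $x\vee x'=\mathbf{1}$; $C(\mathcal{L})$ is the set of elements of $\mathcal{L}$ having a complement. (Under the hypotheses $C(\mathcal{L})$ is a sublattice of $\mathcal{L}$; ''$C(\mathcal{L})$ is Boolean'' means this sublattice is a Boolean algebra.) Linear morphism: a map $\varphi:\mathcal{L}\to\mathcal{L}'$ between bounded lattices is linear if there exist $\ker_\varphi\in\mathcal{L}$ and $a'\in\mathcal{L}'$ such that (1) $\varphi(x)=\varphi(x\vee\ker_\varphi)$ for all $x$; (2) $\varphi$ restricts to a lattice isomorphism $[\ker_\varphi,\mathbf{1}]\to[\mathbf{0},a']$ (so $a'=\varphi(\mathbf{1})$). $\mathrm{End}_{lin}(\mathcal{L})$ is the monoid of linear morphisms $\mathcal{L}\to\mathcal{L}$ under composition; its zero is the constant map $\mathbf{0}$. A submonoid with zero contains the identity and the zero morphism. For $x$ with complement $x'$, the projection $\pi_x$ (with respect to $x'$) is $\pi_x(a)=(a\vee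 x')\wedge x$, viewed with codomain $\mathcal{L}$ or $[\mathbf{0},x]$; $\iota_x:[\mathbf{0},x]\to\mathcal{L}$ is the inclusion. $\mathfrak{m}$ is closed under complements if for every $\varphi\in\mathfrak{m}$ and all $x,y\in C(\mathcal{L})$ such that $\varphi$ restricts to an isomorphism $\varphi|_x:[\mathbf{0},x]\to[\mathbf{0},y]$, one has $\iota_x(\varphi|_x)^{-1}\pi_y\in\mathfrak{m}$ (for every choice of complement of $y$ defining $\pi_y$). $\mathcal{L}$ is $\mathfrak{m}$-endoregular if for each $\varphi\in\mathfrak{m}$ there is $\psi\in\mathfrak{m}$ with $\varphi=\varphi\psi\varphi$; $\mathfrak{m}$-abelian if every idempotent of $\mathfrak{m}$ is central in $\mathfrak{m}$. A semiring is a set $S$ with operations $+,\cdot$ such that $(S,+)$ is a commutative monoid, $(S,\cdot)$ is a monoid, and $a(b+c)=ab+ac$, $(b+c)a=ba+ca$ for all $a,b,c\in S$. *)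

(* Defs.v *)
From mathcomp Require Import all_boot all_order all_algebra all_classical.

Set Implicit Arguments.
Unset Strict Implicit.
Unset Printing Implicit Defensive.

Import Order.TTheory.
Local Open Scope classical_set_scope.
Local Open Scope order_scope.

(* A set of functions [S : set (L -> L)] stands for a subset of the monoid of
   self-maps of L; functions are compared with Leibniz equality, hence up to
   functional extensionality. *)

Definition complete_lattice d (L : porderType d) : Prop :=
  forall A : set L, supremums A !=set0.

Definition modular_lattice d (L : latticeType d) : Prop :=
  forall x y z : L, x <= z -> x `|` (y `&` z) = (x `|` y) `&` z.

Definition is_complement d (L : tbLatticeType d) (x x' : L) : Prop :=
  x `&` x' = \bot /\ x `|` x' = \top.

Definition complemented d (L : tbLatticeType d) : set L :=
  [set x | exists x', is_complement x x'].

(* Only the identities of a Boolean algebra are required, for the operations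
   of L.  For [S = complemented L], closure under meet and join is not part of
   the definition: under the hypotheses of the theorem it always holds. *)
Definition boolean_on d (L : tbLatticeType d) (S : set L) : Prop :=
  [/\ S \bot, S \top,
      forall x, S x -> exists2 x', S x' & is_complement x x'
    & forall x y z, S x -> S y -> S z ->
        x `&` (y `|` z) = (x `&` y) `|` (x `&` z)].

Definition lattice_iso_on d d' (L : latticeType d) (L' : latticeType d')
    (f : L -> L') (A : set L) (B : set L') : Prop :=
  [/\ set_bij A B f,
      forall x y, A x -> A y -> f (x `&` y) = f x `&` f y
    & forall x y, A x -> A y -> f (x `|` y) = f x `|` f y].

Definition linear_morphism d d' (L : tbLatticeType d) (L' : tbLatticeType d')
    (phi : L -> L') : Prop :=
  exists (k : L) (a' : L'),
    (forall x, phi x = phi (x `|` k)) /\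
    lattice_iso_on phi `[k, \top%O]%classic `[\bot%O, a']%classic.

Definition End_lin d (L : tbLatticeType d) : set (L -> L) :=
  [set phi | linear_morphism phi].

Definition submonoid_with_zero d (L : tbLatticeType d) (m : set (L -> L)) :
    Prop :=
  [/\ m `<=` @End_lin d L, m id, m (fun=> \bot)
    & forall phi psi, m phi -> m psi -> m (phi \o psi)].

Definition proj d (L : latticeType d) (x x' : L) : L -> L :=
  fun a => (a `|` x') `&` x.

(* [psi] is any self-map of L that inverts [phi] on [\bot, x]; since [phi] maps
   [\bot, x] onto [\bot, y], which contains the range of [proj y y'],
   [psi \o proj y y'] does not depend on the values of [psi] elsewhere. *)
Definition closed_under_complements d (L : tbLatticeType d)
    (m : set (L -> L)) : Prop :=
  forall (phi : L -> L) (x y : L),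
    m phi -> complemented x -> complemented y ->
    lattice_iso_on phi `[\bot%O, x]%classic `[\bot%O, y]%classic ->
    forall (y' : L) (psi : L -> L), is_complement y y' ->
      (forall b, b <= x -> psi (phi b) = b) ->
      m (psi \o proj y y').

Definition endoregular d (L : tbLatticeType d) (m : set (L -> L)) : Prop :=
  forall phi, m phi -> exists2 psi, m psi & phi = phi \o psi \o phi.

Definition endoabelian d (L : tbLatticeType d) (m : set (L -> L)) : Prop :=
  forall e, m e -> e \o e = e -> forall phi, m phi -> e \o phi = phi \o e.

Definition monoid_on T (S : set T) (op : T -> T -> T) : Prop :=
  [/\ forall a b, S a -> S b -> S (op a b),
      forall a b c, S a -> S b -> S c -> op a (op b c) = op (op a b) c
    & exists2 e, S e & forall a, S a -> op e a = a /\ op a e = a].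

(* The additive identity is not required to be absorbing for [mul], so the
   library's semirings are not suitable. *)
Definition semiring_on T (S : set T) (add mul : T -> T -> T) : Prop :=
  [/\ monoid_on S add,
      forall a b, S a -> S b -> add a b = add b a,
      monoid_on S mul,
      forall a b c, S a -> S b -> S c ->
        mul a (add b c) = add (mul a b) (mul a c)
    & forall a b c, S a -> S b -> S c ->
        mul (add b c) a = add (mul b a) (mul c a)].

(* Main.v *)
Require Import Defs.
From mathcomp Require Import all_boot all_order all_algebra all_classical.

(** Let [e] be an idempotent of [m].  Modularity makes it the projection onto
    [a = e \top] along its kernel [k], and [a], [k] are complements of each
    other; closure under complements, applied to the identity, puts the opposite
    projection [f] (onto [k] along [a]) into [m].  As in ring theory, [e]
    commutes with [phi] as soon as the two corners [f \o phi \o e] and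
    [e \o phi \o f] vanish ([proj_commute]); they play symmetric roles, so only
    [theta = f \o phi \o e] is discussed.

    Booleanness enters through one rigidity fact, [corner_disjoint].  By
    endoregularity the image [w \top] of any [w] in [m] is complemented, hence
    it splits along the decomposition [a `|` k = \top].  So [w] has no
    diagonal part linking [a] with [k]: a morphism that factors both through
    [e \o w] and through [f \o w] is zero.

    The addition produces such diagonal morphisms.  If the zero map [0] were
    known to be neutral for the addition, [w = e + theta] would suffice, being
    the graph of [theta]: [theta \o e \o w = theta = f \o w].  In general the
    same [w] only yields [theta + 0 = 0].  The additive identity [z] supplies
    the rest.  With [theta = theta s theta], both [theta z e] and
    [theta s f z e] are neutral for the addition on the same set
    [theta m e = theta s f m e], hence are equal; rigidity for [w = z \o e]
    shows that they vanish.  So [0] is neutral on [theta m e], and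
    [theta = theta + 0 = 0]. *)

Set Implicit Arguments.
Unset Strict Implicit.
Unset Printing Implicit Defensive.

Import Order.TTheory.
Local Open Scope classical_set_scope.
Local Open Scope order_scope.

Local Notation proj := Defs.proj.

(** * Linear morphisms *)

Section LinearMorphism.
Context (d : Order.disp_t) (L : tbLatticeType d).
Implicit Types (phi e : L -> L) (a k x y : L).

Lemma is_complementC a k : is_complement a k -> is_complement k a.
Proof. by case=> ak0 ak1; split; rewrite (meetC, joinC). Qed.

Lemma linear_join phi x y : linear_morphism phi ->
  phi (x `|` y) = phi x `|` phi y.
Proof.
case=> k [b [phik [_ _ phiU]]].
rewrite (phik x) (phik y) -phiU /= ?in_itv /= ?leUr ?lex1 //.
by rewrite joinACA joinxx -phik.
Qed.

Lemma linear_le phi x y : linear_morphism phi -> x <= y -> phi x <= phi y.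
Proof. by move=> phi_lin /join_idPl <-; rewrite linear_join // leUr. Qed.

Lemma linear_bot phi : linear_morphism phi -> phi \bot = \bot.
Proof.
move=> phi_lin; case: (phi_lin) => k [b [phik [[_ _ phi_surj] _ _]]].
have [|x /= _ phix] := phi_surj \bot; first by rewrite /= in_itv /= lexx le0x.
by apply/eqP; rewrite -lex0 -[X in _ <= X]phix; exact: linear_le (le0x x).
Qed.

Lemma linear_preimage phi y : linear_morphism phi -> y <= phi \top ->
  exists x, phi x = y.
Proof.
case=> k [b [_ [[phi_fun _ phi_surj] _ _]]] y_le.
have /= := phi_fun \top; rewrite !in_itv /= !lex1 => /(_ isT)/andP[_ phi1].
have [|x _ <-] := phi_surj y; last by exists x.
by rewrite /= in_itv /= le0x (le_trans y_le phi1).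
Qed.

(** Modularity is what makes a projection recover its argument modulo the
    kernel. *)
Lemma proj_join a k x : modular_lattice L -> is_complement a k ->
  proj a k x `|` k = x `|` k.
Proof.
move=> modL [_ ak1].
by rewrite /proj joinC (meetC _ a) modL ?leUr // (joinC k) ak1 meet1x.
Qed.

(** The complement of [e \top] is the kernel of [e]: it meets the image
    trivially because [e] fixes its image, and their join has the same image as
    [\top], hence equals [\top] by injectivity above the kernel. *)
Lemma idempotent_proj e : modular_lattice L -> linear_morphism e ->
  e \o e = e -> exists2 k, is_complement (e \top) k & e = proj (e \top) k.
Proof.
move=> modL e_lin ee; have eeE x : e (e x) = e x by rewrite -[in RHS]ee.
have [k [b [ek [[_ e_inj _] _ _]]]] := e_lin.
have fixe y : y <= e \top -> e y = y.
  by move=> /(linear_preimage e_lin)[x <-]; exact: eeE.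
have ek0 : e k = \bot by rewrite -(join0x k) -ek linear_bot.
have meet0 : e \top `&` k = \bot.
  rewrite -(fixe _ (leIl _ k)); apply/eqP.
  by rewrite -lex0 -ek0; apply: linear_le => //; exact: leIr.
have join1 : e \top `|` k = \top.
  by apply: e_inj; rewrite ?inE /= ?in_itv /= ?leUr ?lex1 // -ek eeE.
exists k => //; apply/funext => x; rewrite /proj.
have <- : e ((x `|` k) `&` e \top) = (x `|` k) `&` e \top.
  by apply: fixe; exact: leIr.
rewrite ek [RHS]ek; congr e.
by rewrite -[RHS]/(proj (e \top) k x `|` k) proj_join.
Qed.

Lemma proj_le a k x : proj a k x <= a.
Proof. exact: leIr. Qed.

Lemma proj_bot a k x : is_complement a k -> x <= k -> proj a k x = \bot.
Proof. by case=> ak0 _ xk; rewrite /proj (join_idPr xk) meetC. Qed.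

Lemma proj_id a k x : modular_lattice L -> is_complement a k -> x <= a ->
  proj a k x = x.
Proof. by move=> modL [ka0 _] xa; rewrite /proj -modL // meetC ka0 joinx0. Qed.

(** If both off-diagonal corners vanish then [phi] preserves [a] and [k], and
    modulo [k] every [x] agrees with its projection. *)
Lemma proj_commute a k phi : modular_lattice L -> is_complement a k ->
    linear_morphism phi -> linear_morphism (proj a k) ->
    proj k a \o phi \o proj a k = (fun=> \bot) ->
    proj a k \o phi \o proj k a = (fun=> \bot) ->
  proj a k \o phi = phi \o proj a k.
Proof.
move=> modL ak phi_lin e_lin fpe0 epf0; have ka := is_complementC ak.
apply/funext => x /=.
have -> : phi (proj a k x) = proj a k (phi (proj a k x)).
  move/(congr1 (fun g => g x)) : fpe0 => /= fpe0x.
  rewrite [RHS]proj_id // -[a in X in _ <= X]join0x -fpe0x.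
  by rewrite proj_join // leUl.
have epk0 : proj a k (phi k) = \bot.
  by move/(congr1 (fun g => g k)) : epf0 => /=; rewrite (proj_id modL ka).
rewrite -[LHS]joinx0 -[RHS]joinx0 -epk0 -!linear_join //.
by rewrite proj_join.
Qed.

End LinearMorphism.

(** * Endoregular monoids of linear morphisms *)

Section Corner.
Context (d : Order.disp_t) (L : tbLatticeType d).
Context (m : set (L -> L)).
Hypotheses (modL : modular_lattice L) (mP : submonoid_with_zero m).
Hypothesis regm : endoregular m.

Let lin phi : m phi -> linear_morphism phi.
Proof. by case: mP => mlin _ _ _ /mlin. Qed.

Let comp phi psi : m phi -> m psi -> m (phi \o psi).
Proof. by case: mP => _ _ _; apply. Qed.

(** The image of [phi = phi psi phi] is that of the idempotent [phi psi]. *)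
Lemma complemented_image phi : m phi -> complemented (phi \top).
Proof.
move=> mphi; have [psi mpsi phiE] := regm mphi.
have mpp := comp mphi mpsi.
have [|k kP _] := idempotent_proj modL (lin mpp).
  by apply/funext => x /=; rewrite [in RHS]phiE.
exists k; suff -> : phi \top = (phi \o psi) \top by [].
apply/eqP; rewrite eq_le; apply/andP; split; last first.
  exact: linear_le (lin mphi) (lex1 (psi \top)).
by rewrite {1}phiE; exact: linear_le (lin mpp) (lex1 (phi \top)).
Qed.

Context (boolC : boolean_on (@complemented d L)).
Context (a k : L) (akP : is_complement a k).
Let e := proj a k.
Let f := proj k a.

(** Write the image of [w] as [v1 `|` v2] with [v1] below [a] and [v2] below
    [k].  The second factorisation kills [v1], the first kills [v2]. *)
Lemma corner_disjoint u1 u2 w : m e -> m f -> m u1 -> m u2 -> m w ->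
  u1 \o e \o w = u2 \o f \o w -> u1 \o e \o w = fun=> \bot.
Proof.
move=> me mf mu1 mu2 mw uE; have mu := comp (comp mu1 me) mw.
have kaP := is_complementC akP.
have split_w : w \top = (w \top `&` a) `|` (w \top `&` k).
  have [_ _ _ distC] := boolC.
  rewrite -distC; [by case: akP => _ ->; rewrite meetx1 | | by exists k
    | by exists a].
  exact: complemented_image.
have [t1 wt1] := linear_preimage (lin mw) (leIl (w \top) a).
have [t2 wt2] := linear_preimage (lin mw) (leIl (w \top) k).
have u_t1 : (u1 \o e \o w) t1 = \bot.
  rewrite uE /= wt1 (_ : f _ = \bot); first exact: linear_bot (lin mu2).
  by apply: proj_bot => //; exact: leIr.
have u_t2 : (u1 \o e \o w) t2 = \bot.
  rewrite /= wt2 (_ : e _ = \bot); first exact: linear_bot (lin mu1).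
  by apply: proj_bot => //; exact: leIr.
have u_top : (u1 \o e \o w) \top = \bot.
  rewrite /= split_w -wt1 -wt2 -(linear_join _ _ (lin mw)).
  rewrite -[LHS]/((u1 \o e \o w) (t1 `|` t2)).
  by rewrite (linear_join _ _ (lin mu)) u_t1 u_t2 joinxx.
apply/funext => x; apply/eqP; rewrite -lex0 -u_top.
exact: linear_le (lin mu) (lex1 x).
Qed.

Context (add : (L -> L) -> (L -> L) -> (L -> L)).
Hypothesis addP : semiring_on m add (fun phi psi => phi \o psi).

(** The axioms leave room for additions in which the zero map is not neutral:
    on the two-element lattice, with [m] consisting of the zero map and the
    identity, the pointwise meet makes the zero map absorbing.  So the vanishing
    of [theta + 0] and the equality of [theta + 0] with [theta] are proved
    separately, the second by means of the additive identity [z]. *)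
Lemma corner_eq0 phi : m e -> m f -> m phi -> f \o phi \o e = fun=> \bot.
Proof.
move=> me mf mphi; have kaP := is_complementC akP.
have [_ m1 m0 _] := mP.
have [[addm _ [z mz zP]] addC _ mulDr mulDl] := addP.
set theta := f \o phi \o e.
have mtheta : m theta by exact: comp (comp mf mphi) me.
have mul0 g : m g -> g \o (fun=> \bot) = (fun=> \bot).
  by move=> mg; apply/funext => x /=; rewrite (linear_bot (lin mg)).
have ee : e \o e = e.
  by apply/funext => x; apply: (proj_id modL akP); exact: proj_le.
have ff : f \o f = f.
  by apply/funext => x; apply: (proj_id modL kaP); exact: proj_le.
have ef : e \o f = fun=> \bot.
  by apply/funext => x; apply: (proj_bot akP); exact: proj_le.
have fe : f \o e = fun=> \bot.
  by apply/funext => x; apply: (proj_bot kaP); exact: proj_le.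
have ftheta : f \o theta = theta by rewrite -[LHS]/((f \o f) \o phi \o e) ff.
have thetae : theta \o e = theta by rewrite -[LHS]/(f \o phi \o (e \o e)) ee.
have etheta : e \o theta = fun=> \bot.
  by rewrite -[LHS]/((e \o f) \o (phi \o e)) ef.
have theta_add0 : add theta (fun=> \bot) = fun=> \bot.
  (* [w] would be the graph of [theta] if the zero map were neutral. *)
  pose w := add e theta; have mw : m w by exact: addm.
  have thw : theta \o e \o w = add theta (fun=> \bot).
    rewrite -[LHS]/(theta \o (e \o w)) mulDr // ee etheta mulDr // ?mul0 //.
    by rewrite thetae.
  have fw : id \o f \o w = add theta (fun=> \bot).
    by rewrite -[LHS]/(f \o w) mulDr // fe ftheta addC.
  by rewrite -thw; apply: (corner_disjoint (u2 := id)) => //; rewrite thw.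
have mze := comp mz me.
have ze_add g : m g -> g \o e = g -> add (z \o e) g = g.
  by move=> mg ge; rewrite -[in LHS]ge -mulDl // (zP _ mg).1.
have [s ms thetaE] := regm mtheta.
have mts := comp mtheta ms.
have mtsf := comp mts mf.
have mtze := comp mtheta mze.
have msfze : m (s \o f \o (z \o e)) by exact: comp (comp ms mf) mze.
have neutral_eq : theta \o e \o (z \o e) = (theta \o s) \o f \o (z \o e).
  have tzeE : theta \o (z \o e) = (theta \o s \o f) \o (theta \o (z \o e)).
    rewrite -[RHS]/((theta \o s \o (f \o theta)) \o (z \o e)) ftheta.
    by rewrite -thetaE.
  rewrite thetae.
  (* Both sides equal their sum. *)
  transitivity (add (theta \o s \o f \o (z \o e)) (theta \o (z \o e))).
    rewrite [in X in _ = add _ X]tzeE -mulDr // ze_add //.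
    by rewrite -[LHS]/(theta \o z \o (e \o e)) ee.
  rewrite addC //; last exact: comp mtsf mze.
  rewrite -[X in add _ X]/(theta \o (s \o f \o (z \o e))) -mulDr //.
  rewrite ze_add //.
  by rewrite -[LHS]/(s \o f \o z \o (e \o e)) ee.
have tze0 := corner_disjoint me mf mtheta mts mze neutral_eq.
rewrite -theta_add0 addC // -tze0 thetae -[in X in _ = add _ X]thetae.
by rewrite -mulDr // ze_add // thetae.
Qed.

End Corner.

Theorem corollary3p32 (d : Order.disp_t) (L : tbLatticeType d)
    (hcomplete : complete_lattice L) (hmodular : modular_lattice L)
    (m : set (L -> L))
    (hm : submonoid_with_zero m)
    (hcc : closed_under_complements m)
    (add : (L -> L) -> (L -> L) -> (L -> L))
    (hsemiring : semiring_on m add (fun phi psi => phi \o psi))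
    (hreg : endoregular m)
    (hbool : boolean_on (@complemented d L)) :
  endoabelian m.
Proof.
have [mlin m1 _ _] := hm.
move=> e me ee phi mphi; have e_lin := mlin _ me.
have [k akP eE] := idempotent_proj hmodular e_lin ee.
move: akP eE; set a := e \top => akP eE; have kaP := is_complementC akP.
have mf : m (proj k a).
  have iso1 : lattice_iso_on (@id L) `[\bot, k]%classic `[\bot, k]%classic.
    by split=> //; split=> // y yk; exists y.
  by apply: (hcc id k k m1 _ _ iso1 a id) => //; exists a.
rewrite {}eE in me e_lin *.
apply: proj_commute => //; first exact: mlin.
  exact: (corner_eq0 hmodular hm hreg hbool akP hsemiring).
exact: (corner_eq0 hmodular hm hreg hbool kaP hsemiring).
Qed.
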